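(* Let $(\mathcal P,\le_{\mathcal P})$ and $(\mathcal Q,\le_{\mathcal Q})$ be finite posets, and assume that $\mathcal Q$ has a least element $0_{\mathcal Q}$. Suppose that $\mu_{\mathcal P},\nu_{\mathcal P}$ are probability measures on $\mathcal P$ and $\mu_{\mathcal Q},\nu_{\mathcal Q}$ are probability measures on $\mathcal Q$ satisfying $$\mu_{\mathcal P}\preceq_{HS}\nu_{\mathcal P}\ \text{ on }\mathcal P,\qquad \mu_{\mathcal Q}\preceq_{HS}\nu_{\mathcal Q}\ \text{ on }\mathcal Q.$$ Let $\alpha,\beta\ge0$ satisfy $\alpha+\beta=1$, and define probability measures on the ordinal sum $\mathcal P\oplus\mathcal Q$ by $$\mu=\alpha\,\mu_{\mathcal P}+\beta\,\mu_{\mathcal Q},\qquad \nu=\alpha\,\nu_{\mathcal P}+\beta\,\nu_{\mathcal Q},$$ where each component measure is extended by zero outside its original support. Then $\mu\preceq_{HS}\nu$ on $\mathcal P\oplus\mathcal Q$.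
   Context: For a finite poset $(\mathcal P,\le)$ and $x,z\in\mathcal P$, the hockey-stick function is $\Phi_x^{\mathcal P}(z):=\sum_{y\in\mathcal P}\mathbb 1_{\{x\le y\le z\}}$. For a signed measure $\rho$ on $\mathcal P$ and $f:\mathcal P\to\mathbb R$, $\langle\rho,f\rangle:=\int_{\mathcal P}f(x)\,\rho(dx)$. For signed measures $\mu,\nu$ on $\mathcal P$, $\mu\preceq_{HS}\nu$ on $\mathcal P$ means that $\langle\nu-\mu,\Phi_x^{\mathcal P}\rangle\ge0$ for every $x\in\mathcal P$. The ordinal sum $\mathcal P\oplus\mathcal Q$ is the set $\mathcal P\sqcup\mathcal Q$ with order: $x\le y$ if and only if ($x,y\in\mathcal P$ and $x\le_{\mathcal P}y$), or ($x,y\in\mathcal Q$ and $x\le_{\mathcal Q}y$), or ($x\in\mathcal P$ and $y\in\mathcal Q$). *)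

(* Defs.v *)
From HB Require Import structures.
From mathcomp Require Import all_boot all_order all_algebra reals.

Set Implicit Arguments.
Unset Strict Implicit.
Unset Printing Implicit Defensive.

Import Order.TTheory GRing.Theory Num.Theory.
Local Open Scope ring_scope.

(* An alias of the disjoint union, so that the order below does not become the
   canonical order of [P + Q]; [inl] and [inr] are the two inclusions. *)
Definition ordsum (P Q : Type) : Type := (P + Q)%type.

HB.instance Definition _ (P Q : choiceType) :=
  Choice.copy (ordsum P Q) (P + Q)%type.
HB.instance Definition _ (P Q : finType) :=
  Finite.copy (ordsum P Q) (P + Q)%type.

Fact ordsum_display (d d' : Order.disp_t) : Order.disp_t.
Proof. exact: Order.Disp tt tt. Qed.

Section OrdinalSumOrder.
Context {d d' : Order.disp_t} (P : porderType d) (Q : porderType d').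

Definition ordsum_le (x y : ordsum P Q) : bool :=
  match x, y with
  | inl p, inl p' => (p <= p')%O
  | inr q, inr q' => (q <= q')%O
  | inl _, inr _ => true
  | inr _, inl _ => false
  end.

Fact ordsum_le_refl : reflexive ordsum_le.
Proof. by case=> x /=. Qed.

Fact ordsum_le_anti : antisymmetric ordsum_le.
Proof. by case=> x [] y //= /le_anti ->. Qed.

Fact ordsum_le_trans : transitive ordsum_le.
Proof. by case=> y [] x [] z //=; apply: le_trans. Qed.

HB.instance Definition _ :=
  Order.Le_isPOrder.Build (ordsum_display d d') (ordsum P Q)
    ordsum_le_refl ordsum_le_anti ordsum_le_trans.

Lemma leEordsum (x y : ordsum P Q) : (x <= y)%O = ordsum_le x y.
Proof. by []. Qed.

End OrdinalSumOrder.

HB.instance Definition _ (d d' : Order.disp_t)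
    (P : finPOrderType d) (Q : finPOrderType d') :=
  Order.POrder.on (ordsum P Q).

(* A signed measure rho on a finite set T is represented by its mass function
   x |-> rho({x}) in [{ffun T -> R}]; the difference nu - mu of signed measures is
   then the pointwise difference. *)
Definition is_probability (R : realType) (T : finType)
    (mu : {ffun T -> R}) : Prop :=
  (forall x, 0 <= mu x) /\ \sum_x mu x = 1.

(* The integral of [f] against the signed measure with mass function [rho]. *)
Definition pairing (R : realType) (T : finType)
    (rho : {ffun T -> R}) (f : T -> R) : R :=
  \sum_x f x * rho x.

Definition hockey_stick (R : realType) (d : Order.disp_t)
    (P : finPOrderType d) (x z : P) : R :=
  \sum_(y : P) ((x <= y <= z)%O : bool)%:R.

Definition le_HS (R : realType) (d : Order.disp_t) (P : finPOrderType d)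
    (mu nu : {ffun P -> R}) : Prop :=
  forall x : P, 0 <= pairing (nu - mu) (hockey_stick R x).

Section ExtensionByZero.
Context {R : realType} {P Q : finType}.

Definition extend_inl (mu : {ffun P -> R}) : {ffun ordsum P Q -> R} :=
  [ffun s : ordsum P Q =>
    match s return R with inl p => mu p | inr _ => 0 end].

Definition extend_inr (mu : {ffun Q -> R}) : {ffun ordsum P Q -> R} :=
  [ffun s : ordsum P Q =>
    match s return R with inl _ => 0 | inr q => mu q end].

Definition mixture (a b : R) (muP : {ffun P -> R}) (muQ : {ffun Q -> R}) :
    {ffun ordsum P Q -> R} :=
  [ffun s => a * extend_inl muP s + b * extend_inr muQ s].

Lemma is_probability_mixture (a b : R) (muP : {ffun P -> R})
    (muQ : {ffun Q -> R}) :
  0 <= a -> 0 <= b -> a + b = 1 ->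
  is_probability muP -> is_probability muQ ->
  is_probability (mixture a b muP muQ).
Proof.
move=> a0 b0 ab [P0 P1] [Q0 Q1]; split=> [s|].
  by rewrite !ffunE; case: s => x; rewrite addr_ge0// mulr_ge0.
rewrite big_sumType /=.
under eq_bigr do rewrite !ffunE mulr0 addr0.
under [X in _ + X]eq_bigr do rewrite !ffunE mulr0 add0r.
by rewrite -!mulr_sumr P1 Q1 !mulr1.
Qed.

End ExtensionByZero.

(* Main.v *)
(* On the Q part, the hockey-stick function based at a point p of P is the one of Q
   based at its least element plus the constant #{y in P | p <= y}, and a
   difference of two probability measures annihilates constants. *)

Require Import Defs.
From mathcomp Require Import all_boot all_order all_algebra reals.

Set Implicit Arguments.
Unset Strict Implicit.
Unset Printing Implicit Defensive.

Import Order.TTheory GRing.Theory Num.Theory.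
Local Open Scope ring_scope.

(** The extensions by zero have disjoint supports, so with [a] and [b] nonnegative the sign can be
    checked on each summand separately. *)
Lemma pairing_mixtureB (R : realType) (P Q : finType) (a b : R)
    (muP nuP : {ffun P -> R}) (muQ nuQ : {ffun Q -> R}) (f : ordsum P Q -> R) :
  pairing (mixture a b nuP nuQ - mixture a b muP muQ) f =
  a * pairing (nuP - muP) (f \o inl) + b * pairing (nuQ - muQ) (f \o inr).
Proof.
rewrite /pairing big_sumType /= !mulr_sumr; congr (_ + _);
  apply: eq_bigr => x _; rewrite !ffunE !mulr0 ?addr0 ?add0r -mulrBr;
  exact: mulrCA.
Qed.

Lemma pairing_addcst (R : realType) (T : finType) (mu nu : {ffun T -> R})
    (c : R) (f : T -> R) :
  is_probability mu -> is_probability nu ->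
  pairing (nu - mu) (fun x => c + f x) = pairing (nu - mu) f.
Proof.
move=> [_ mu1] [_ nu1]; rewrite /pairing.
under eq_bigr do rewrite mulrDl.
rewrite big_split /= -mulr_sumr.
have -> : \sum_x (nu - mu) x = 0.
  under eq_bigr do rewrite !ffunE.
  by rewrite sumrB mu1 nu1 subrr.
by rewrite mulr0 add0r.
Qed.

(** Lets the hockey-stick identities below, which hold pointwise, be used under [pairing]. *)
Lemma eq_pairing (R : realType) (T : finType) (rho : {ffun T -> R})
    (f g : T -> R) : f =1 g -> pairing rho f = pairing rho g.
Proof. by move=> fg; apply: eq_bigr => x _; rewrite fg. Qed.

Section HockeyStickOrdsum.
Context {R : realType} {d d' : Order.disp_t}.

(** No element of [Q] lies below one of [P], so the interval stays inside [P]. *)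
Lemma hockey_stick_inl_inl (P : finPOrderType d) (Q : finPOrderType d')
    (p p' : P) :
  hockey_stick R (inl p : ordsum P Q) (inl p') = hockey_stick R p p'.
Proof.
by rewrite /hockey_stick big_sumType /= [X in _ + X]big1 ?addr0.
Qed.

Lemma hockey_stick_inr_inl (P : finPOrderType d) (Q : finPOrderType d')
    (q : Q) (p : P) :
  hockey_stick R (inr q : ordsum P Q) (inl p) = 0.
Proof.
by rewrite /hockey_stick big1// => -[y|y] _; rewrite !leEordsum /= ?andbF.
Qed.

Lemma hockey_stick_inr_inr (P : finPOrderType d) (Q : finPOrderType d')
    (q q' : Q) :
  hockey_stick R (inr q : ordsum P Q) (inr q') = hockey_stick R q q'.
Proof.
by rewrite /hockey_stick big_sumType /= [X in X + _]big1 ?add0r.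
Qed.

(** The interval consists of the up-set of [p] in [P] and the down-set of [q] in [Q]; the latter is
    the interval from [\bot] to [q]. *)
Lemma hockey_stick_inl_inr (P : finPOrderType d) (Q : finBPOrderType d')
    (p : P) (q : Q) :
  hockey_stick R (inl p : ordsum P Q) (inr q) =
  \sum_(y : P) ((p <= y)%O : bool)%:R + hockey_stick R (\bot : Q)%O q.
Proof.
rewrite /hockey_stick big_sumType /=; congr (_ + _); apply: eq_bigr => y _.
  by rewrite !leEordsum /= andbT.
by rewrite !leEordsum /= le0x.
Qed.

End HockeyStickOrdsum.

Theorem proposition5p4 (R : realType) (d d' : Order.disp_t)
    (P : finPOrderType d) (Q : finBPOrderType d')
    (muP nuP : {ffun P -> R}) (muQ nuQ : {ffun Q -> R}) (a b : R)
    (muP_prob : is_probability muP) (nuP_prob : is_probability nuP)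
    (muQ_prob : is_probability muQ) (nuQ_prob : is_probability nuQ)
    (le_muP_nuP : le_HS muP nuP) (le_muQ_nuQ : le_HS muQ nuQ)
    (a_ge0 : 0 <= a) (b_ge0 : 0 <= b) (ab1 : a + b = 1) :
  le_HS (P := ordsum P Q) (mixture a b muP muQ) (mixture a b nuP nuQ).
Proof.
case=> [p|q]; rewrite pairing_mixtureB addr_ge0// mulr_ge0//.
- by rewrite (eq_pairing _ (hockey_stick_inl_inl Q p)).
(* Once the constant is dropped, this is [le_muQ_nuQ] at [\bot]. *)
- by rewrite (eq_pairing _ (hockey_stick_inl_inr p)) pairing_addcst.
(* Based at a point of [Q], the hockey-stick function vanishes on [P]. *)
- rewrite (eq_pairing _ (hockey_stick_inr_inl q)) /pairing big1// => x _.
  by rewrite mul0r.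
- by rewrite (eq_pairing _ (hockey_stick_inr_inr P q)).
Qed.
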